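(* Let $\gamma,u,v\in\Bbbk^\ast$. Let $\sigma$ be the automorphism of $\Bbbk_{-1}[x,y]$ given by $\sigma(x)=\gamma x$, $\sigma(y)=\gamma y$, and let $\eta_{u,v}$ be the flip automorphism $\eta_{u,v}(x)=uy$, $\eta_{u,v}(y)=vx$. Let $$\delta=[w,\_]_\sigma+\mathcal P_x+\mathcal P_y+\lambda_1D_x+\lambda_2D_y$$ be the decomposition of a $\sigma$-derivation $\delta$ of $\Bbbk_{-1}[x,y]$ described in the context. Then $\eta_{u,v}\in\mathrm{Aut}_\delta(\Bbbk_{-1}[x,y])$ if and only if the following conditions hold: (i) $\eta_{u,v}(w)-w\in\mathcal Z_\gamma(\Bbbk_{-1}[x,y])$, where $$\mathcal Z_\gamma(\Bbbk_{-1}[x,y])=\{a\in\Bbbk_{-1}[x,y]:\ a\sigma(b)=ba\ \text{for all } b\in\Bbbk_{-1}[x,y]\};$$ more explicitly, $\mathcal Z_\gamma(\Bbbk_{-1}[x,y])$ equals $0$ if $\gamma\neq\pm1$, equals $\Bbbk[x^2,y^2]$ if $\gamma=1$, and equals $\Bbbk[x^2,y^2]\,yx$ if $\gamma=-1$. (ii) If $\gamma=-1$ (so that the families $\mathcal P_x$ and $\mathcal P_y$ may occur), then $$a(y)=v^{-1}b(uy)\quad\text{and}\quad b(x)=u^{-1}a(vx).$$ (iii) If $\gamma=\pm1$ (so that the families $D_x$ and $D_y$ may occur), then $$\lambda_1=c_\gamma(u,v)\,\eta_{u,v}(\lambda_2)\quad\text{and}\quad\lambda_2=c_\gamma(u,v)\,\eta_{u,v}(\lambda_1),$$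 where $c_\gamma(u,v)=1$ if $\gamma=1$ and $c_\gamma(u,v)=-uv$ if $\gamma=-1$.
   Context: $\Bbbk$ is an algebraically closed field of characteristic zero. $\Bbbk_{-1}[x,y]$ is the $\Bbbk$-algebra generated by $x,y$ with the relation $xy=-yx$; its center is $\Bbbk[x^2,y^2]$. For an automorphism $\sigma$ of an algebra $A$, a $\sigma$-derivation is a $\Bbbk$-linear map $\delta:A\to A$ with $\delta(ab)=\delta(a)\sigma(b)+a\delta(b)$ for all $a,b\in A$. For $w\in A$, $[w,\_]_\sigma$ is the inner $\sigma$-derivation $b\mapsto w\sigma(b)-bw$. The isotropy group of $\delta$ is $\mathrm{Aut}_\delta(A)=\{\rho\in\mathrm{Aut}(A):\rho\sigma=\sigma\rho,\ \rho\delta=\delta\rho\}$. Decomposition: for $\sigma(x)=\gamma x$, $\sigma(y)=\gamma y$, every $\sigma$-derivation of $\Bbbk_{-1}[x,y]$ can be written as $[w,\_]_\sigma+\mathcal P_x+\mathcal P_y+\lambda_1D_x+\lambda_2D_y$ with $w\in\Bbbk_{-1}[x,y]$ and $\lambda_1,\lambda_2\in\Bbbk[x^2,y^2]$, where: - if $\gamma=-1$, $\mathcal P_x$ and $\mathcal P_y$ are the $\sigma$-derivations with $\mathcal P_x(x)=a(y)$, $\mathcal P_x(y)=0$ and $\mathcal P_y(x)=0$, $\mathcal P_y(y)=b(x)$ for some $a(y)\in\Bbbk[y]$, $b(x)\in\Bbbk[x]$ (possibly zero); if $\gamma\neq-1$, $\mathcal P_x=\mathcal P_y=0$; - if $\gamma=1$,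 $D_x(x)=x$, $D_x(y)=0$, $D_y(x)=0$, $D_y(y)=y$; if $\gamma=-1$, $D_x(x)=(yx)x$, $D_x(y)=0$, $D_y(x)=0$, $D_y(y)=(yx)y$; if $\gamma\neq\pm1$, $D_x=D_y=0$. The notation $b(uy)$ (resp. $a(vx)$) means substitution of $uy$ (resp. $vx$) for the variable in the one-variable polynomial. *)

(* Defs.v *)
From HB Require Import structures.
From mathcomp Require Import all_boot all_order all_algebra.

Set Implicit Arguments.
Unset Strict Implicit.
Unset Printing Implicit Defensive.

Import GRing.Theory.
Local Open Scope ring_scope.

(* (A, x, y) is the unital algebra generated by x and y subject to the single
   relation x y = - y x, i.e. k_{-1}[x,y]: this is the universal property of
   the presentation, which determines (A, x, y) up to unique isomorphism. *)
Definition is_quantum_plane (k : fieldType) (A : algType k) (x y : A) : Prop :=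
  x * y = - (y * x) /\
  forall (B : algType k) (x' y' : B), x' * y' = - (y' * x') ->
    exists f : {lrmorphism A -> B},
      [/\ f x = x', f y = y' &
          forall g : {lrmorphism A -> B}, g x = x' -> g y = y' -> g =1 f].

Record algAut (k : fieldType) (A : algType k) := AlgAut {
  algAut_val :> {lrmorphism A -> A};
  algAut_bij : bijective algAut_val
}.

Definition sderivation (k : fieldType) (A : algType k) (sigma : algAut A)
    (delta : {linear A -> A}) : Prop :=
  forall a b : A, delta (a * b) = delta a * sigma b + a * delta b.

Definition sinner (k : fieldType) (A : algType k) (sigma : algAut A)
    (w b : A) : A :=
  w * sigma b - b * w.

Definition isotropy (k : fieldType) (A : algType k) (sigma : algAut A)
    (delta : {linear A -> A}) (rho : algAut A) : Prop :=
  (forall a : A, rho (sigma a) = sigma (rho a)) /\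
  (forall a : A, rho (delta a) = delta (rho a)).

Definition scenter (k : fieldType) (A : algType k) (sigma : algAut A)
    (a : A) : Prop :=
  forall b : A, a * sigma b = b * a.

(* k[x^2, y^2]; x^2 and y^2 commute in k_{-1}[x,y], so the order of the two
   factors in each monomial is immaterial. *)
Definition in_kx2y2 (k : fieldType) (A : algType k) (x y : A) (p : A) : Prop :=
  exists (n : nat) (c : 'M[k]_n),
    p = \sum_(i < n) \sum_(j < n) c i j *: ((x ^+ 2) ^+ i * (y ^+ 2) ^+ j).

(* [horner_alg y a] is a(y), the one-variable polynomial a evaluated at y. *)
Definition is_Px (k : fieldType) (A : algType k) (x y : A) (gamma : k)
    (sigma : algAut A) (a : {poly k}) (P : {linear A -> A}) : Prop :=
  if gamma == -1 then
    [/\ sderivation sigma P, P x = horner_alg y a & P y = 0]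
  else forall c : A, P c = 0.

Definition is_Py (k : fieldType) (A : algType k) (x y : A) (gamma : k)
    (sigma : algAut A) (b : {poly k}) (P : {linear A -> A}) : Prop :=
  if gamma == -1 then
    [/\ sderivation sigma P, P x = 0 & P y = horner_alg x b]
  else forall c : A, P c = 0.

Definition is_Dx (k : fieldType) (A : algType k) (x y : A) (gamma : k)
    (sigma : algAut A) (D : {linear A -> A}) : Prop :=
  if gamma == 1 then [/\ sderivation sigma D, D x = x & D y = 0]
  else if gamma == -1 then
    [/\ sderivation sigma D, D x = (y * x) * x & D y = 0]
  else forall c : A, D c = 0.

Definition is_Dy (k : fieldType) (A : algType k) (x y : A) (gamma : k)
    (sigma : algAut A) (D : {linear A -> A}) : Prop :=
  if gamma == 1 then [/\ sderivation sigma D, D x = 0 & D y = y]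
  else if gamma == -1 then
    [/\ sderivation sigma D, D x = 0 & D y = (y * x) * y]
  else forall c : A, D c = 0.

(* Only meaningful for gamma = 1 or gamma = -1. *)
Definition cflip (k : fieldType) (gamma u v : k) : k :=
  if gamma == 1 then 1 else - (u * v).

(* Main.v *)
Require Import Defs.
From HB Require Import structures.
From mathcomp Require Import all_boot all_order all_algebra.
From mathcomp Require Import ring.

Set Implicit Arguments.
Unset Strict Implicit.
Unset Printing Implicit Defensive.

Import GRing.Theory.
Local Open Scope ring_scope.

(** The algebra k_{-1}[x,y] has a basis of normal monomials x^i y^j, so that an
    element of A is the same thing as a commutative polynomial in X and Y, its
    normal form [nf]. Multiplying an element by a generator multiplies the
    normal form by X or Y, up to the substitution [signY] : Y -> -Y when x is
    put on the right, and [signX] : X -> -X when y is put on the left. In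
    this way every identity to be studied becomes an identity between
    commutative polynomials acted on by two commuting involutions.

    Existence of the normal form ([exists_normal_form]) has to be extracted
    from the universal property. The space k[X][Y] with the product twisted by
    these involutions is an algebra B in which XY = -YX; hence a morphism
    f : A -> B. Reading a polynomial as a sum of normal monomials of A gives a
    morphism from B back to A, and the composite fixes x and y, so it is the
    identity.

    A sigma-commuting condition at the generators says that [nf] is
    an eigenvector of the two involutions, which gives the description of
    Z_gamma ([scenter_nf] and its corollaries), because an element whose
    normal form has fixed parities in X and in Y is a product of an element
    of k[x^2,y^2] by x^e y^e' ([parity_kx2y2]).

    For the isotropy group, eta commutes with sigma, and both eta delta and
    delta eta are twisted by the same pair (eta, sigma eta) in the Leibniz
    rule, so that they agree as soon as they agree at x and y. Up to the
    factors u and v, the differences at x and y are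

      (d sigma(y) - y d) + (u^-1 a(vx) - b(x)) + (u^-1 eta(l1) eta(D_x x) - l2 D_y y),
      (d sigma(x) - x d) + (v^-1 b(uy) - a(y)) + (v^-1 eta(l2) eta(D_y y) - l1 D_x x),

    with d = eta(w) - w. The three summands involve disjoint sets of
    monomials: for instance, when gamma = -1, in the second line the first
    summand only has monomials x^i y^j with i > 0 and j even, the second
    only has i = 0, and the third only has i > 0 and j odd. So the
    sum vanishes if and only if each summand does (the lemmas
    [commutator_x_separation] to [anticommutator_y_separation]), and these
    vanishing conditions are (i), (ii) and (iii). *)

(** * Sign substitutions on commutative polynomials in X and Y *)

Section Signs.
Variable k : fieldType.
Implicit Types P Q : {poly {poly k}}.

(** A polynomial of k[X][Y] has coefficients in k[X]: the outer
    indeterminate is Y, and [P`_j`_i] is the coefficient of X^i Y^j. *)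
Definition signX : {poly {poly k}} -> {poly {poly k}} :=
  map_poly (comp_poly (- 'X)).
Definition signY : {poly {poly k}} -> {poly {poly k}} := comp_poly (- 'X).
HB.instance Definition _ := GRing.RMorphism.on signX.
HB.instance Definition _ := GRing.RMorphism.on signY.

Definition varX : {poly {poly k}} := 'X%:P.
Definition varY : {poly {poly k}} := 'X.

Lemma coef_comp_polyNX (R : comNzRingType) (p : {poly R}) i :
  (p \Po (- 'X))`_i = (-1) ^+ i * p`_i.
Proof.
elim/poly_ind: p i => [|p c IHp] i; first by rewrite comp_poly0 !coef0 mulr0.
rewrite comp_polyD comp_polyM comp_polyX comp_polyC mulrN !coefD coefN !coefMX.
rewrite !coefC; case: i => [|i] /=; first by rewrite oppr0 !add0r expr0 mul1r.
by rewrite IHp !addr0 exprS mulN1r mulNr.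
Qed.

Lemma coef_signX P j i : (signX P)`_j`_i = (-1) ^+ i * P`_j`_i.
Proof. by rewrite /signX coef_map coef_comp_polyNX. Qed.

Lemma coef_signY P j i : (signY P)`_j`_i = (-1) ^+ j * P`_j`_i.
Proof.
rewrite /signY coef_comp_polyNX -!(signr_odd _ j).
by case: (odd j); rewrite ?expr0 ?mul1r // expr1 !mulN1r coefN.
Qed.

Lemma poly2P P Q : (forall j i, P`_j`_i = Q`_j`_i) -> P = Q.
Proof. by move=> eqPQ; apply/polyP => j; apply/polyP => i. Qed.

Lemma signXK : involutive signX.
Proof.
by move=> P; apply: poly2P => j i; rewrite !coef_signX mulrA -expr2 sqrr_sign mul1r.
Qed.

Lemma signYK : involutive signY.
Proof.
by move=> P; apply: poly2P => j i; rewrite !coef_signY mulrA -expr2 sqrr_sign mul1r.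
Qed.

Lemma signXY P : signX (signY P) = signY (signX P).
Proof.
by apply: poly2P => j i; rewrite !(coef_signX, coef_signY) mulrCA.
Qed.

Lemma signXM : {morph signX : P Q / P * Q}.
Proof. exact: rmorphM. Qed.
Lemma signYM : {morph signY : P Q / P * Q}.
Proof. exact: rmorphM. Qed.
Lemma signXD : {morph signX : P Q / P + Q}.
Proof. exact: rmorphD. Qed.
Lemma signYD : {morph signY : P Q / P + Q}.
Proof. exact: rmorphD. Qed.
Lemma signXN : {morph signX : P / - P}.
Proof. exact: rmorphN. Qed.
Lemma signYN : {morph signY : P / - P}.
Proof. exact: rmorphN. Qed.

Lemma signX_X : signX varX = - varX.
Proof. by rewrite /signX /varX map_polyC /= comp_polyX polyCN. Qed.
Lemma signX_Y : signX varY = varY.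
Proof. exact: map_polyX. Qed.
Lemma signY_X : signY varX = varX.
Proof. exact: comp_polyC. Qed.
Lemma signY_Y : signY varY = - varY.
Proof. exact: comp_polyX. Qed.
Lemma signX_scalar (c : k) : signX c%:P%:P = c%:P%:P.
Proof. by rewrite /signX map_polyC /= comp_polyC. Qed.
Lemma signY_scalar (c : k) : signY c%:P%:P = c%:P%:P.
Proof. exact: comp_polyC. Qed.
End Signs.

(** * The twisted algebra structure on k[X][Y] *)

Section TwistedAlgebra.
Variables (k : fieldType) (two_neq0 : 2%:R != 0 :> k).

(** A copy of k[X][Y] that carries the twisted product; the proof that 2 is
    invertible is a parameter because the product involves 1/2. *)
Definition twisted of 2%:R != 0 :> k := {poly {poly k}}.
Notation B := (twisted two_neq0).
HB.instance Definition _ := GRing.Zmodule.copy B {poly {poly k}}.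
Implicit Types P Q S : {poly {poly k}}.

(* One half, locked so that unfolding stops at this constant. *)
Fact half_key : unit. Proof. exact: tt. Qed.
Definition half : {poly {poly k}} := locked_with half_key (2%:R^-1)%:P%:P.
Lemma halfE : half * 2%:R = 1.
Proof. by rewrite /half unlock -!polyC_natr -!polyCM mulVf. Qed.

(** The normally ordered product: a power Y^j of P can only be moved to the right
    of Q by changing X to (-1)^j X in Q. Half of P + signY P and half of
    P - signY P are the parts of P of even and of odd degree in Y; writing them
    through the involution turns the ring axioms into polynomial identities. *)
Definition tmul P Q : {poly {poly k}} :=
  half * ((P + signY P) * Q + (P - signY P) * signX Q).

Lemma tmul_even P Q : signY P = P -> tmul P Q = P * Q.
Proof. by move=> sP; rewrite -[RHS]mul1r -halfE /tmul sP; ring. Qed.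

Lemma tmul_odd P Q : signY P = - P -> tmul P Q = P * signX Q.
Proof. by move=> sP; rewrite -[RHS]mul1r -halfE /tmul sP; ring. Qed.

Lemma tmul_fixX P Q : signX Q = Q -> tmul P Q = P * Q.
Proof. by move=> sQ; rewrite -[RHS]mul1r -halfE /tmul sQ; ring. Qed.

Lemma tmul_antiX P Q : signX Q = - Q -> tmul P Q = signY P * Q.
Proof. by move=> sQ; rewrite -[RHS]mul1r -halfE /tmul sQ; ring. Qed.

Lemma half_const : signX half = half /\ signY half = half.
Proof. by rewrite /half unlock signX_scalar signY_scalar. Qed.

Lemma signX_tmul P Q : signX (tmul P Q) = tmul (signX P) (signX Q).
Proof.
by rewrite /tmul !(signXM, signXD, signXN) !signXY (proj1 half_const).
Qed.

Lemma signY_tmul P Q : signY (tmul P Q) = tmul (signY P) (signY Q).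
Proof.
by rewrite /tmul !(signYM, signYD, signYN) !signXY (proj2 half_const).
Qed.

(** Both involutions are automorphisms of the twisted product and they
    commute; after pushing them to the leaves, associativity is an identity of
    commutative rings. *)
Lemma tmulA : associative tmul.
Proof.
move=> P Q S; rewrite [tmul P (tmul Q S)]/tmul [tmul (tmul P Q) S]/tmul.
rewrite signX_tmul signY_tmul /tmul signXK signYK signXY.
move: (signY (signX Q)) (signX Q) (signY Q) (signY P) (signX S) => Q3 Q2 Q1 P1 S1.
ring.
Qed.

Lemma tmulCl (c : k) P Q : c%:P%:P * tmul P Q = tmul (c%:P%:P * P) Q.
Proof. by rewrite /tmul signYM signY_scalar; ring. Qed.
Lemma tmulCr (c : k) P Q : c%:P%:P * tmul P Q = tmul P (c%:P%:P * Q).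
Proof. by rewrite /tmul signXM signX_scalar; ring. Qed.

Lemma tmul1p : left_id 1 tmul.
Proof. by move=> P; rewrite tmul_even ?rmorph1 ?mul1r. Qed.
Lemma tmulp1 : right_id 1 tmul.
Proof. by move=> P; rewrite tmul_fixX ?rmorph1 ?mulr1. Qed.
Lemma tmulDl : left_distributive tmul +%R.
Proof. by move=> P Q S; rewrite /tmul rmorphD /=; ring. Qed.
Lemma tmulDr : right_distributive tmul +%R.
Proof. by move=> P Q S; rewrite /tmul rmorphD /=; ring. Qed.

HB.instance Definition _ := GRing.Zmodule_isNzRing.Build B
  tmulA tmul1p tmulp1 tmulDl tmulDr (oner_neq0 {poly {poly k}}).

Definition tscale (c : k) (P : B) : B := c%:P%:P * (P : {poly {poly k}}).
Lemma tscaleA c d P : tscale c (tscale d P) = tscale (c * d) P.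
Proof. by rewrite /tscale mulrA -!polyCM. Qed.
Lemma tscale1 : left_id 1 tscale.
Proof. by move=> P; rewrite /tscale mul1r. Qed.
Lemma tscaleDr : right_distributive tscale +%R.
Proof. by move=> c P Q; rewrite /tscale mulrDr. Qed.
Lemma tscaleDl (P : B) : {morph tscale^~ P : c d / c + d}.
Proof. by move=> c d; rewrite /tscale !polyCD mulrDl. Qed.
HB.instance Definition _ := GRing.Zmodule_isLmodule.Build k B
  tscaleA tscale1 tscaleDr tscaleDl.

Lemma tscaleAl (c : k) (P Q : B) : c *: (P * Q) = (c *: P) * Q.
Proof. exact: tmulCl. Qed.
HB.instance Definition _ := GRing.Lmodule_isLalgebra.Build k B tscaleAl.
Lemma tscaleAr (c : k) (P Q : B) : c *: (P * Q) = P * (c *: Q).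
Proof. exact: tmulCr. Qed.
HB.instance Definition _ := GRing.Lalgebra_isAlgebra.Build k B tscaleAr.
End TwistedAlgebra.

(** * Normal forms of elements of the quantum plane *)

Section Generation.
Variables (k : fieldType) (A : algType k) (x y : A).
Hypothesis xy : x * y = - (y * x).

Lemma rmorph_horner_alg (C : algType k) (h : {lrmorphism A -> C}) (z : A) p :
  h (horner_alg z p) = horner_alg (h z) p.
Proof.
elim/poly_ind: p => [|p c IHp]; first by rewrite !rmorph0.
by rewrite !rmorphD !rmorphM /= !horner_algX !horner_algC IHp linearZ rmorph1.
Qed.

Lemma y_horner_alg p :
  y * horner_alg x p = horner_alg x (p \Po (- 'X)) * y.
Proof.
elim/poly_ind: p => [|p c IHp]; first by rewrite comp_poly0 !rmorph0 mulr0 mul0r.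
rewrite comp_polyD comp_polyM comp_polyX comp_polyC !rmorphD !rmorphM /= rmorphN.
rewrite /= horner_algX !horner_algC mulrDr mulrDl mulrA IHp mulr_algl mulr_algr.
by congr (_ + _); rewrite -!mulrA mulNr xy opprK.
Qed.

(** Reading X^i Y^j as the normal monomial x^i y^j: the coefficients, which are
    polynomials in x, stand to the left of the powers of y. *)
Definition normal_eval (P : {poly {poly k}}) : A :=
  (map_poly (horner_alg x) P).[y].

Lemma normal_evalD : {morph normal_eval : P Q / P + Q}.
Proof. by move=> P Q; rewrite /normal_eval rmorphD hornerD. Qed.

Lemma normal_evalCM p Q : normal_eval (p%:P * Q) = horner_alg x p * normal_eval Q.
Proof. by rewrite /normal_eval rmorphM /= map_polyC hornerCM. Qed.

Lemma normal_evalC p : normal_eval p%:P = horner_alg x p.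
Proof. by rewrite /normal_eval map_polyC hornerC. Qed.

Lemma normal_evalMY P : normal_eval (P * 'X) = normal_eval P * y.
Proof. by rewrite /normal_eval rmorphM /= map_polyX hornerMX. Qed.

Lemma normal_eval_signX Q : normal_eval (signX Q) * y = y * normal_eval Q.
Proof.
elim/poly_ind: Q => [|Q p IHQ].
  by rewrite /signX rmorph0 /normal_eval rmorph0 horner0 mulr0 mul0r.
rewrite signXD signXM signX_Y normal_evalD normal_evalMY mulrDl IHQ.
rewrite normal_evalD normal_evalMY mulrDr mulrA; congr (_ + _).
by rewrite /signX map_polyC !normal_evalC y_horner_alg.
Qed.

Variable two_neq0 : 2%:R != 0 :> k.

(** Induction on the Y-degree of the left factor: a left factor in k[X] goes
    through the evaluation, and a left factor Y is moved through the
    right one by [normal_eval_signX]. *)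
Lemma normal_eval_tmul P Q :
  normal_eval (tmul P Q) = normal_eval P * normal_eval Q.
Proof.
have const p S : normal_eval (tmul p%:P S) = horner_alg x p * normal_eval S.
  by rewrite tmul_even ?normal_evalCM // /signY comp_polyC.
elim/poly_ind: P Q => [|P p IHP] Q.
  by rewrite -[0]/(0%:P) const normal_evalC.
rewrite tmulDl normal_evalD const normal_evalD normal_evalC mulrDl.
congr (_ + _).
rewrite normal_evalMY -(tmul_fixX two_neq0 P (signX_Y k)) -tmulA // IHP.
rewrite tmul_odd ?signY_Y // /varY mulrC normal_evalMY normal_eval_signX.
by rewrite mulrA.
Qed.
End Generation.

Section NormalForm.
Variables (k : fieldType) (two_neq0 : 2%:R != 0 :> k).
Variables (A : algType k) (x y : A).
Hypothesis hA : is_quantum_plane x y.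
Notation B := (twisted two_neq0).

(** Uniqueness in the universal property, applied to the composite
    A -> B -> A and to the identity, shows that normal monomials span A; their
    independence is built into B. *)
Lemma exists_normal_form :
  exists f : {lrmorphism A -> B},
    [/\ f x = varX k, f y = varY k & forall z, normal_eval x y (f z) = z].
Proof.
have [xy univ] := hA.
have relB : (varX k : B) * (varY k : B) = - ((varY k : B) * (varX k : B)).
  change (tmul (varX k) (varY k) = - tmul (varY k) (varX k)).
  rewrite tmul_even ?signY_X // tmul_odd ?signY_Y // signX_X mulrN opprK.
  exact: mulrC.
have [f [fx fy _]] := univ B _ _ relB; exists f; split=> // z.
pose g : B -> A := normal_eval x y.
have gB : zmod_morphism g.
  by move=> P Q; rewrite /g /normal_eval rmorphB hornerD hornerN.
have gM : monoid_morphism g.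
  split; first by rewrite /g /normal_eval rmorph1 hornerC.
  by move=> P Q; exact: normal_eval_tmul.
have gZ : scalable g.
  move=> c P; rewrite /g [X in normal_eval _ _ X]/(_ *: _) /= normal_evalCM.
  by rewrite horner_algC mulr_algl.
pose gm := GRing.isZmodMorphism.Build _ _ g gB.
pose gr := GRing.isMonoidMorphism.Build _ _ g gM.
pose gl := GRing.isScalable.Build _ _ _ _ g gZ.
pose G : {lrmorphism B -> A} := HB.pack g gm gr gl.
have [h [_ _ hU]] := univ A x y xy.
have Gfx : (G \o f : {lrmorphism A -> A}) x = x.
  by rewrite /= fx /g normal_evalC horner_algX.
have Gfy : (G \o f : {lrmorphism A -> A}) y = y.
  by rewrite /= fy /g /normal_eval map_polyX hornerX.
transitivity (h z); first exact: (hU (G \o f : {lrmorphism A -> A}) Gfx Gfy z).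
by rewrite -(hU (idfun : {lrmorphism A -> A})).
Qed.
End NormalForm.

Section Coordinates.
Variables (k : fieldType) (two_neq0 : 2%:R != 0 :> k).
Variables (A : algType k) (x y : A).
Variable f : {lrmorphism A -> twisted two_neq0}.
Hypothesis xy : x * y = - (y * x).
(* These three properties are the conclusion of [exists_normal_form]. *)
Hypotheses (fx : f x = varX k) (fy : f y = varY k).
Hypothesis fK : forall z, normal_eval x y (f z) = z.

(** The same function as [f], with values in the commutative ring k[X][Y], so
    that its values can be multiplied there. *)
Definition nf (z : A) : {poly {poly k}} := f z.

Lemma nf_inj : injective nf.
Proof. exact: (can_inj fK). Qed.
Lemma nf0 : nf 0 = 0. Proof. exact: (raddf0 f). Qed.
Lemma nfD : {morph nf : z t / z + t}. Proof. exact: (raddfD f). Qed.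
Lemma nfN : {morph nf : z / - z}. Proof. exact: (raddfN f). Qed.
Lemma nfZ c z : nf (c *: z) = c%:P%:P * nf z. Proof. exact: (linearZ_LR f). Qed.
Lemma nf1 : nf 1 = 1. Proof. exact: (rmorph1 f). Qed.
Lemma nfM z t : nf (z * t) = tmul (nf z) (nf t). Proof. exact: (rmorphM f). Qed.
Lemma nfx : nf x = varX k. Proof. exact: fx. Qed.
Lemma nfy : nf y = varY k. Proof. exact: fy. Qed.

Lemma nf_mulX z : nf (z * x) = signY (nf z) * varX k.
Proof. by rewrite nfM nfx tmul_antiX ?signX_X. Qed.
Lemma nf_mulY z : nf (z * y) = nf z * varY k.
Proof. by rewrite nfM nfy tmul_fixX ?signX_Y. Qed.
Lemma nf_Xmul z : nf (x * z) = varX k * nf z.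
Proof. by rewrite nfM nfx tmul_even ?signY_X. Qed.
Lemma nf_Ymul z : nf (y * z) = varY k * signX (nf z).
Proof. by rewrite nfM nfy tmul_odd ?signY_Y. Qed.

(** Normal forms exhibit every element as obtained from x, y and the scalars
    by sums and products. *)
Lemma generator_ind (S : A -> Prop) :
    (forall z t, S z -> S t -> S (z + t)) ->
    (forall z t, S z -> S t -> S (z * t)) ->
    (forall c, S c%:A) -> S x -> S y -> forall z, S z.
Proof.
move=> SD SM SC Sx Sy z; rewrite -(fK z).
have Sp p : S (horner_alg x p).
  elim/poly_ind: p => [|p c IHp]; first by rewrite -[0]/(0%:P) horner_algC.
  by rewrite rmorphD rmorphM /= horner_algX horner_algC; auto.
elim/poly_ind: (f z : {poly {poly k}}) => [|P p IHP].
  by rewrite -[0]/(0%:P) normal_evalC.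
by rewrite normal_evalD normal_evalMY normal_evalC; auto.
Qed.

(** The normal form is even in X and in Y; such elements turn out to be those
    of k[x^2,y^2]. *)
Definition even_nf z := signX (nf z) = nf z /\ signY (nf z) = nf z.

Lemma even_nfM z t : even_nf z -> even_nf t -> even_nf (z * t).
Proof.
move=> [zX zY] [tX tY]; split; rewrite nfM.
  by rewrite signX_tmul zX tX.
by rewrite signY_tmul zY tY.
Qed.
Lemma even_nfD z t : even_nf z -> even_nf t -> even_nf (z + t).
Proof.
by move=> [zX zY] [tX tY]; split; rewrite nfD ?signXD ?signYD; congr (_ + _).
Qed.
Lemma even_nfC c : even_nf c%:A.
Proof.
by split; rewrite nfZ nf1 mulr1 ?signX_scalar ?signY_scalar.
Qed.
Lemma even_nfZ c z : even_nf z -> even_nf (c *: z).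
Proof. by move=> ez; rewrite -mulr_algl; apply: even_nfM => //; apply: even_nfC. Qed.
Lemma even_nfX z n : even_nf z -> even_nf (z ^+ n).
Proof.
move=> ez; elim: n => [|n IHn]; first by rewrite -[_ ^+ 0]scale1r; apply: even_nfC.
by rewrite exprS; apply: even_nfM.
Qed.
Lemma even_nf_sum n (F : 'I_n -> A) :
  (forall i, even_nf (F i)) -> even_nf (\sum_(i < n) F i).
Proof.
move=> eF; apply: (big_ind even_nf) => //; last exact: even_nfD.
by rewrite -(scale0r 1); apply: even_nfC.
Qed.

Lemma even_nf_sqrX : even_nf (x ^+ 2).
Proof.
rewrite expr2; split; rewrite nf_mulX nfx signY_X ?signXM ?signYM ?signX_X ?signY_X //.
exact: mulrNN.
Qed.

Lemma even_nf_sqrY : even_nf (y ^+ 2).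
Proof.
rewrite expr2; split; rewrite nf_mulY nfy ?signXM ?signYM ?signX_Y ?signY_Y //.
exact: mulrNN.
Qed.

Lemma even_nf_kx2y2 z : in_kx2y2 x y z -> even_nf z.
Proof.
case=> n [c ->]; apply: even_nf_sum => i; apply: even_nf_sum => j.
apply/even_nfZ/even_nfM; apply: even_nfX.
  exact: even_nf_sqrX.
exact: even_nf_sqrY.
Qed.

Lemma horner_alg_wide (C : algType k) (t : C) (p : {poly k}) n : (size p <= n)%N ->
  horner_alg t p = \sum_(i < n) p`_i *: t ^+ i.
Proof.
move=> len; rewrite /horner_alg /horner_morph.
rewrite (horner_coef_wide _ (leq_trans (size_poly _ _) len)).
by apply: eq_bigr => i _; rewrite coef_map /= mulr_algl.
Qed.

(** The number of terms is made even, and common to both exponents, in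
    order to pair exponents 2i and 2i+1 and to meet the square arrays of
    coefficients that define k[x^2,y^2]. *)
Lemma nf_expansion z : exists n,
  z = \sum_(i < n.*2) \sum_(j < n.*2) (nf z)`_j`_i *: (x ^+ i * y ^+ j).
Proof.
pose m := \max_(j < size (nf z)) size ((nf z)`_j)%R.
exists (maxn (size (nf z)) m).
set n := maxn _ _.
have le2 t : (t <= n -> t <= n.*2)%N.
  by move/leq_trans; apply; rewrite -addnn leq_addr.
have lenY : (size (nf z) <= n.*2)%N by rewrite le2 // leq_maxl.
have lenX j : (size ((nf z)`_j)%R <= n.*2)%N.
  case: (ltnP j (size (nf z))) => [ltj | gej].
    rewrite le2 // (leq_trans _ (leq_maxr _ _)) //.
    exact: (@leq_bigmax _ (fun i : 'I_(size (nf z)) => size ((nf z)`_i)%R) (Ordinal ltj)).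
  by rewrite (nth_default _ gej) size_poly0.
rewrite -{1}(fK z) exchange_big /= /normal_eval.
rewrite (horner_coef_wide _ (leq_trans (size_poly _ _) lenY)).
apply: eq_bigr => j _; rewrite coef_map /= (horner_alg_wide _ (lenX j)) mulr_suml.
by apply: eq_bigr => i _; rewrite scalerAl.
Qed.

Lemma sum_parity (e : bool) n (F : nat -> A) :
    (forall i, odd i != e -> F i = 0) ->
  \sum_(i < n.*2) F i = \sum_(i < n) F (e + i.*2)%N.
Proof.
move=> F0; elim: n => [|n IHn]; first by rewrite !big_ord0.
rewrite doubleS !big_ord_recr /= IHn -addrA; congr (_ + _).
have odd2 : odd n.*2 = false := odd_double n.
case: e F0 {IHn} => F0; first by rewrite F0 ?odd2 ?add0r.
by rewrite [F _.+1]F0 ?addr0 //= odd2.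
Qed.

Lemma oppr_fix0 (c : k) : c = - c -> c = 0.
Proof.
move/eqP; rewrite -addr_eq0 -mulr2n -mulr_natl mulf_eq0 (negPf two_neq0).
by move/eqP.
Qed.

Lemma signr_fix0 (e : bool) n (c : k) :
  (-1) ^+ n * c = (-1) ^+ e * c -> odd n != e -> c = 0.
Proof.
rewrite -signr_odd; case: (odd n); case: e => //=.
  by rewrite expr1 expr0 mulN1r mul1r => /esym/oppr_fix0.
by rewrite expr1 expr0 mulN1r mul1r => /oppr_fix0.
Qed.

(** Only monomials x^(ex+2i) y^(ey+2j) occur in such a z, and the surplus
    factors x^ex y^ey can be moved to the right because x commutes with y^2. *)
Lemma parity_kx2y2 (ex ey : bool) z :
    signX (nf z) = (-1) ^+ ex * nf z -> signY (nf z) = (-1) ^+ ey * nf z ->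
  exists p, in_kx2y2 x y p /\ z = p * (x ^+ ex * y ^+ ey).
Proof.
have coef_sign (e : bool) (P : {poly {poly k}}) j i :
    ((-1) ^+ e * P)`_j`_i = (-1) ^+ e * P`_j`_i.
  by case: e; rewrite ?mul1r // expr1 !mulN1r !coefN.
have coefP P Q j i : P = Q :> {poly {poly k}} -> P`_j`_i = Q`_j`_i by move=> ->.
move=> zX zY; have [n zE] := nf_expansion z.
pose c := \matrix_(i < n, j < n) (nf z)`_(ey + j.*2)`_(ex + i.*2).
exists (\sum_(i < n) \sum_(j < n) c i j *: ((x ^+ 2) ^+ i * (y ^+ 2) ^+ j)).
split; first by exists n, c.
have xyy : GRing.comm x (y ^+ 2).
  by rewrite /GRing.comm expr2 [LHS]mulrA xy mulNr -(mulrA y x) xy mulrN opprK mulrA.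
rewrite {1}zE.
rewrite (@sum_parity ex n
  (fun i => \sum_(j < n.*2) (nf z)`_j`_i *: (x ^+ i * y ^+ j))); last first.
  move=> i odd_i; apply: big1 => j _; have := coefP _ _ j i zX.
  by rewrite coef_signX coef_sign => /signr_fix0 ->; rewrite ?scale0r.
rewrite mulr_suml; apply: eq_bigr => i _.
rewrite (@sum_parity ey n
  (fun j => (nf z)`_j`_(ex + i.*2) *: (x ^+ (ex + i.*2) * y ^+ j))); last first.
  move=> j odd_j; have := coefP _ _ j (ex + i.*2)%N zY.
  by rewrite coef_signY coef_sign => /signr_fix0 ->; rewrite ?scale0r.
rewrite mulr_suml; apply: eq_bigr => j _.
rewrite mxE -scalerAl; congr (_ *: _).
rewrite addnC exprD [(ey + _)%N]addnC exprD -!exprM !mul2n -!mulrA.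
congr (_ * _); rewrite mulrA -mul2n exprM.
by rewrite (commrX _ (commr_sym (commrX ex (commr_sym xyy)))) !mulrA.
Qed.

Lemma kx2y2_even z : even_nf z -> in_kx2y2 x y z.
Proof.
move=> [zX zY].
have [|| p [pE ->]] := @parity_kx2y2 false false z; rewrite ?mul1r //.
by rewrite !expr0 !mulr1.
Qed.

Lemma signY_parity0 (P : {poly {poly k}}) : signY P = P -> signY P = - P -> P = 0.
Proof.
move=> -> PN; apply: poly2P => j i; rewrite !coef0; apply: oppr_fix0.
by rewrite {1}PN !coefN.
Qed.

Lemma signX_parity0 (P : {poly {poly k}}) : signX P = P -> signX P = - P -> P = 0.
Proof.
move=> -> PN; apply: poly2P => j i; rewrite !coef0; apply: oppr_fix0.
by rewrite {1}PN !coefN.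
Qed.

Lemma varX_neq0 : varX k != 0. Proof. by rewrite polyC_eq0 polyX_eq0. Qed.
Lemma varY_neq0 : varY k != 0. Proof. by rewrite polyX_eq0. Qed.

Lemma kx2y2Z c m : in_kx2y2 x y m -> in_kx2y2 x y (c *: m).
Proof. by move=> em; apply/kx2y2_even/even_nfZ/even_nf_kx2y2. Qed.

Lemma kx2y2B m1 m2 : in_kx2y2 x y m1 -> in_kx2y2 x y m2 -> in_kx2y2 x y (m1 - m2).
Proof.
move=> e1 e2; apply: kx2y2_even; rewrite -scaleN1r.
by apply: even_nfD; [|apply: even_nfZ]; apply: even_nf_kx2y2.
Qed.

Lemma flip_kx2y2 (eta : algAut A) (u v : k) m :
    eta x = u *: y -> eta y = v *: x -> in_kx2y2 x y m -> in_kx2y2 x y (eta m).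
Proof.
move=> ex ey [n [c ->]]; apply: kx2y2_even; rewrite raddf_sum.
apply: even_nf_sum => i; rewrite raddf_sum; apply: even_nf_sum => j.
rewrite /= linearZ /= rmorphM !rmorphXn /= ex ey.
by apply/even_nfZ/even_nfM; apply: even_nfX; rewrite exprZn;
  apply: even_nfZ; [exact: even_nf_sqrY | exact: even_nf_sqrX].
Qed.

(** * The sigma-center *)

Section Center.
Variables (gamma : k) (sigma : algAut A).
Hypotheses (hsx : sigma x = gamma *: x) (hsy : sigma y = gamma *: y).

Lemma scenter_generators z :
  scenter sigma z <-> z * sigma x = x * z /\ z * sigma y = y * z.
Proof.
split=> [zc | [zx zy]]; first by split; apply: zc.
apply: generator_ind => //.
- by move=> b c zb zc; rewrite rmorphD mulrDr mulrDl zb zc.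
- by move=> b c zb zc; rewrite rmorphM mulrA zb -mulrA zc mulrA.
- by move=> c; rewrite linearZ rmorph1 /= mulr_algr mulr_algl.
Qed.

(** Sigma-commutation with x is z (gamma x) = x z. On normal forms the left side
    is gamma signY(nf z) X and the right side X (nf z), and X cancels. *)
Lemma sigma_central_x z : (z * sigma x = x * z) <-> gamma%:P%:P * signY (nf z) = nf z.
Proof.
have e : nf (z * sigma x) = varX k * (gamma%:P%:P * signY (nf z)).
  by rewrite hsx -scalerAr nfZ nf_mulX; ring.
split=> [E | E]; last by apply: nf_inj; rewrite e E nf_Xmul.
by apply: (mulfI varX_neq0); rewrite -e E nf_Xmul.
Qed.

Lemma sigma_central_y z : (z * sigma y = y * z) <-> gamma%:P%:P * nf z = signX (nf z).
Proof.
have e : nf (z * sigma y) = varY k * (gamma%:P%:P * nf z).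
  by rewrite hsy -scalerAr nfZ nf_mulY; ring.
split=> [E | E]; last by apply: nf_inj; rewrite e E nf_Ymul.
by apply: (mulfI varY_neq0); rewrite -e E nf_Ymul.
Qed.

Lemma scenter_nf z : scenter sigma z <->
  gamma%:P%:P * signY (nf z) = nf z /\ gamma%:P%:P * nf z = signX (nf z).
Proof. by rewrite scenter_generators sigma_central_x sigma_central_y. Qed.

(** Applying signY to gamma signY(nf z) = nf z and substituting gives
    gamma^2 (nf z) = nf z, where gamma^2 differs from 1. *)
Lemma scenter_generic : gamma <> 1 /\ gamma <> -1 ->
  forall z, scenter sigma z <-> z = 0.
Proof.
move=> [g1 gN1] z; split=> [/scenter_nf[zY _] | ->]; last first.
  by move=> b; rewrite mul0r mulr0.
have sZ : gamma%:P%:P * nf z = signY (nf z).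
  by rewrite -[in RHS]zY signYM signY_scalar signYK.
have : (gamma ^+ 2 - 1)%:P%:P * nf z == 0.
  by rewrite expr2 !polyCB !polyCM mulrBl -mulrA sZ zY mul1r subrr.
rewrite mulf_eq0 !polyC_eq0 subr_eq0 sqrf_eq1 => /orP[/orP[] /eqP // | /eqP z0].
by apply: nf_inj; rewrite nf0.
Qed.

Lemma scenter_one : gamma = 1 ->
  forall z, scenter sigma z <-> in_kx2y2 x y z.
Proof.
move=> g1 z; rewrite scenter_nf g1 !mul1r.
split=> [[zY zX] | /even_nf_kx2y2[-> ->] //].
exact: kx2y2_even.
Qed.

Lemma scenter_minus_one : gamma = -1 ->
  forall z, scenter sigma z <-> exists p, in_kx2y2 x y p /\ z = p * (y * x).
Proof.
move=> gN1 z; rewrite scenter_nf gN1 !polyCN !mulN1r; split=> [[zY zX] | [p []]].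
  have [|| p [pE ->]] := @parity_kx2y2 true true z; rewrite ?mulN1r //.
    by rewrite -{2}zY opprK.
  exists (- p); split; last by rewrite !expr1 xy mulrN mulNr.
  apply: kx2y2_even; rewrite -scaleN1r; apply/even_nfZ/even_nf_kx2y2/pE.
move=> /even_nf_kx2y2[pX pY] ->.
have -> : nf (p * (y * x)) = - (nf p * varY k * varX k).
  by rewrite mulrA nf_mulX nf_mulY signYM signY_Y pY mulrN mulNr.
rewrite signXN signYN !signXM !signYM signX_X signY_X signX_Y signY_Y pX pY.
by split; ring.
Qed.
End Center.

(** * Independence of the three kinds of terms *)

(** A polynomial in y has a normal form free of X. The factor c serves both
    b(uy) and, with c = 1, a(y). *)
Lemma nf_horner_y c p j i : (0 < i)%N -> (nf (horner_alg (c *: y) p))`_j`_i = 0.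
Proof.
move=> i_gt0; elim/poly_ind: p j => [|p d IHp] j.
  by rewrite rmorph0 nf0 !coef0.
rewrite rmorphD rmorphM /= horner_algX horner_algC nfD -scalerAr !nfZ nf1.
rewrite nf_mulY mulr1 !coefD coefCM coefMX !coefC; case: j => [|j] /=.
  by rewrite mulr0 coef0 add0r coefC gtn_eqF.
by rewrite coefCM IHp mulr0 coef0 addr0.
Qed.

Lemma nf_horner_x c p j : (0 < j)%N -> (nf (horner_alg (c *: x) p))`_j = 0.
Proof.
move=> j_gt0; elim/poly_ind: p => [|p d IHp].
  by rewrite rmorph0 nf0 !coef0.
rewrite rmorphD rmorphM /= horner_algX horner_algC nfD -scalerAr !nfZ nf1.
rewrite nf_mulX mulr1 !coefD coefCM coefMC /signY coef_comp_polyNX IHp coefC.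
by rewrite gtn_eqF // mulr0 mul0r mulr0 addr0.
Qed.

(** The commutator of D with x is X times a polynomial that is odd in Y, while
    m x is X times one that is even in Y. *)
Lemma commutator_x_separation D m : in_kx2y2 x y m -> D * x - x * D + m * x = 0 -> m = 0.
Proof.
move=> /even_nf_kx2y2[_ mY] /(congr1 nf); rewrite !(nfD, nfN, nf0) !nf_mulX nf_Xmul mY.
move=> E; apply: nf_inj; rewrite nf0; apply: signY_parity0 => //.
have {E} /eqP : varX k * (signY (nf D) - nf D + nf m) = 0 by rewrite -E; ring.
rewrite mulf_eq0 (negPf varX_neq0) addrC addr_eq0 => /eqP E.
by rewrite {1}E !(signYN, signYD) signYK E opprK; ring.
Qed.

(** The mirror image: the commutator with y is Y times a polynomial that is odd
    in X. *)
Lemma commutator_y_separation D m : in_kx2y2 x y m -> D * y - y * D + m * y = 0 -> m = 0.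
Proof.
move=> /even_nf_kx2y2[mX _] /(congr1 nf); rewrite !(nfD, nfN, nf0) !nf_mulY nf_Ymul.
move=> E; apply: nf_inj; rewrite nf0; apply: signX_parity0 => //.
have {E} /eqP : varY k * (nf D - signX (nf D) + nf m) = 0 by rewrite -E; ring.
rewrite mulf_eq0 (negPf varY_neq0) addrC addr_eq0 => /eqP E.
by rewrite {1}E !(signXN, signXD) signXK E opprK; ring.
Qed.

(** All terms but r are divisible by X, so r, which is a polynomial in y, is
    zero. After division by X, the anticommutator is even in Y and the
    last term, N = (nf m) Y X, is odd in Y. *)
Lemma anticommutator_x_separation D r m : in_kx2y2 x y m ->
    (forall j i, (0 < i)%N -> (nf r)`_j`_i = 0) ->
  - (D * x) - x * D + r - m * (y * x * x) = 0 -> r = 0 /\ m = 0.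
Proof.
move=> /even_nf_kx2y2[_ mY] rY /(congr1 nf).
rewrite !mulrA !(nfD, nfN, nf0) !nf_mulX nf_mulY nf_Xmul !signYM.
rewrite !signYK signY_X => E.
set N := nf m * varY k * varX k.
have rE : nf r = varX k * (signY (nf D) + nf D + N).
  by apply/eqP; rewrite -subr_eq0 -E /N; apply/eqP; ring.
have r0 : nf r = 0.
  apply: poly2P => j [|i]; last by rewrite rY // !coef0.
  by rewrite rE coefCM coefXM !coef0.
move/esym/eqP: rE; rewrite r0 mulf_eq0 (negPf varX_neq0) addr_eq0 => /eqP sD.
split; first by apply: nf_inj; rewrite nf0.
have /eqP : N = 0.
  apply: signY_parity0.
    by apply: oppr_inj; rewrite -signYN -sD signYD signYK addrC.
  by rewrite /N !signYM mY signY_X signY_Y; ring.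
rewrite !mulf_eq0 (negPf varX_neq0) (negPf varY_neq0) !orbF => /eqP m0.
by apply: nf_inj; rewrite nf0.
Qed.

(** All terms but r are divisible by Y, so r, which is a polynomial in x, is
    zero. After division by Y, the anticommutator is even in X and the
    last term is odd in X. *)
Lemma anticommutator_y_separation D r m : in_kx2y2 x y m ->
    (forall j, (0 < j)%N -> (nf r)`_j = 0) ->
  - (D * y) - y * D + r - m * (y * x * y) = 0 -> r = 0 /\ m = 0.
Proof.
move=> /even_nf_kx2y2[mX mY] rX /(congr1 nf).
rewrite !mulrA !(nfD, nfN, nf0) !nf_mulY nf_mulX nf_mulY nf_Ymul !signYM.
rewrite signY_Y mY => E.
set N := nf m * varY k * varX k.
have rE : nf r = varY k * (nf D + signX (nf D) - N).
  by apply/eqP; rewrite -subr_eq0 -E /N; apply/eqP; ring.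
have r0 : nf r = 0.
  apply/polyP => -[|j]; last by rewrite rX // coef0.
  by rewrite rE coefXM coef0.
move/esym/eqP: rE; rewrite r0 mulf_eq0 (negPf varY_neq0) subr_eq0 => /eqP sD.
split; first by apply: nf_inj; rewrite nf0.
have /eqP : N = 0.
  apply: signX_parity0; first by rewrite -sD signXD signXK addrC.
  by rewrite /N !signXM mX signX_X signX_Y; ring.
rewrite !mulf_eq0 (negPf varX_neq0) (negPf varY_neq0) !orbF => /eqP m0.
by apply: nf_inj; rewrite nf0.
Qed.

(** * Reduction of the isotropy condition to the generators *)

Lemma algAut_scalar (s : algAut A) c : s c%:A = c%:A.
Proof. by rewrite linearZ rmorph1. Qed.

(** If eta commutes with sigma, then eta delta and delta eta obey the same
    twisted Leibniz rule, so the set where they agree is a subalgebra; it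
    contains the scalars because delta 1 = 2 delta 1. *)
Lemma isotropy_generators (sigma eta : algAut A) (delta : {linear A -> A}) :
    sderivation sigma delta ->
    eta (sigma x) = sigma (eta x) -> eta (sigma y) = sigma (eta y) ->
  isotropy sigma delta eta <->
    eta (delta x) = delta (eta x) /\ eta (delta y) = delta (eta y).
Proof.
move=> hd sx sy; split=> [[_ ed] // | [dx dy]].
have d1 : delta 1 = 0.
  by have /eqP := hd 1 1; rewrite rmorph1 !mulr1 mul1r addrC -subr_eq subrr eq_sym => /eqP.
have es z : eta (sigma z) = sigma (eta z).
  apply: (generator_ind (S := fun z => eta (sigma z) = sigma (eta z))) => //.
  - by move=> b c eb ec; rewrite !rmorphD /= eb ec.
  - by move=> b c eb ec; rewrite !rmorphM /= eb ec.
  - by move=> c; rewrite !algAut_scalar.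
split=> // z.
apply: (generator_ind (S := fun z => eta (delta z) = delta (eta z))) => //.
- by move=> b c eb ec; rewrite !raddfD /= eb ec.
- by move=> b c eb ec; rewrite hd rmorphD !rmorphM /= eb ec es -hd.
- by move=> c; rewrite algAut_scalar linearZ /= d1 scaler0 rmorph0.
Qed.
End Coordinates.

(** * The isotropy condition *)

Lemma sub_regroup (V : zmodType) (a a' b b' p p' q q' : V) :
  (a - b + p + q) - (a' - b' + p' + q') =
  (a - a') - (b - b') + (p - p') + (q - q').
Proof.
rewrite [- (_ + q')]opprD addrACA; congr (_ + _).
rewrite [- (_ + p')]opprD addrACA; congr (_ + _).
by rewrite opprD addrACA -opprD.
Qed.

Theorem proposition19 (k : closedFieldType) (char0 : [pchar k] =i pred0)
    (A : algType k) (x y : A) (hA : is_quantum_plane x y)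
    (gamma u v : k) (hgamma : gamma != 0) (hu : u != 0) (hv : v != 0)
    (sigma : algAut A)
    (hsx : sigma x = gamma *: x) (hsy : sigma y = gamma *: y)
    (eta : algAut A)
    (hex : eta x = u *: y) (hey : eta y = v *: x)
    (a b : {poly k}) (w l1 l2 : A)
    (hl1 : in_kx2y2 x y l1) (hl2 : in_kx2y2 x y l2)
    (Px Py Dx Dy : {linear A -> A})
    (hPx : is_Px x y gamma sigma a Px) (hPy : is_Py x y gamma sigma b Py)
    (hDx : is_Dx x y gamma sigma Dx) (hDy : is_Dy x y gamma sigma Dy)
    (delta : {linear A -> A}) (hdelta : sderivation sigma delta)
    (hdec : forall c : A,
       delta c = sinner sigma w c + Px c + Py c + l1 * Dx c + l2 * Dy c) :
  (isotropy sigma delta eta <->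
     [/\ scenter sigma (eta w - w),
         gamma = -1 ->
           horner_alg y a = v^-1 *: horner_alg (u *: y) b /\
           horner_alg x b = u^-1 *: horner_alg (v *: x) a
       & gamma = 1 \/ gamma = -1 ->
           l1 = cflip gamma u v *: eta l2 /\
           l2 = cflip gamma u v *: eta l1])
  /\
  [/\ gamma <> 1 /\ gamma <> -1 ->
        forall z : A, scenter sigma z <-> z = 0,
      gamma = 1 ->
        forall z : A, scenter sigma z <-> in_kx2y2 x y z
    & gamma = -1 ->
        forall z : A, scenter sigma z <->
          exists p : A, in_kx2y2 x y p /\ z = p * (y * x)].
Proof.
have two_neq0 : 2%:R != 0 :> k by have := char0 2; rewrite !inE /= => ->.
have [f [fx fy fK]] := exists_normal_form two_neq0 hA.
have [xy _] := hA.
(* The cases gamma = 1 and gamma = -1 exclude each other. *)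
have one_neqN1 : 1 != -1 :> k.
  by rewrite -addr_eq0 -[1 + 1]/(2%:R).
split; last split; first last.
- by move=> gN1; apply: (scenter_minus_one xy fx fy fK hsx hsy gN1).
- by move=> g1; apply: (scenter_one xy fx fy fK hsx hsy g1).
- by move=> g; apply: (scenter_generic fx fy fK hsx hsy g).
have sx : eta (sigma x) = sigma (eta x).
  by rewrite hsx hex !linearZ /= hsy hex !scalerA mulrC.
have sy : eta (sigma y) = sigma (eta y).
  by rewrite hsy hey !linearZ /= hsx hey !scalerA mulrC.
have Px_y : Px y = 0.
  by move: hPx; rewrite /is_Px; case: ifP => _; [case | apply].
have Py_x : Py x = 0.
  by move: hPy; rewrite /is_Py; case: ifP => _; [case | apply].
have Dx_y : Dx y = 0.
  move: hDx; rewrite /is_Dx; case: ifP => _; first by case.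
  by case: ifP => _; [case | apply].
have Dy_x : Dy x = 0.
  move: hDy; rewrite /is_Dy; case: ifP => _; first by case.
  by case: ifP => _; [case | apply].
have iso := isotropy_generators fK hdelta sx sy.
set d := eta w - w; have centd := scenter_generators fK sigma d.
have el1 : in_kx2y2 x y (eta l1) by apply: (flip_kx2y2 xy fx fy fK hex hey).
have el2 : in_kx2y2 x y (eta l2) by apply: (flip_kx2y2 xy fx fy fK hex hey).
(* The differences at the generators, divided by u and by v. *)
have Ex : eta (delta x) = delta (eta x) <->
    (d * sigma y - y * d) + (u^-1 *: eta (Px x) - Py y)
      + (u^-1 *: (eta l1 * eta (Dx x)) - l2 * Dy y) = 0.
  have eq1 := sub_regroup (eta w * sigma y) (w * sigma y) (y * eta w) (y * w)
    (u^-1 *: eta (Px x)) (Py y) (u^-1 *: (eta l1 * eta (Dx x))) (l2 * Dy y).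
  rewrite /d mulrBl mulrBr -eq1.
  have -> : delta (eta x) = u *: (w * sigma y - y * w + Py y + l2 * Dy y).
    by rewrite hex linearZ /= hdec Px_y Dx_y mulr0 !addr0.
  have -> : eta (delta x) = u *: (eta w * sigma y - y * eta w
      + u^-1 *: eta (Px x) + u^-1 *: (eta l1 * eta (Dx x))).
    rewrite hdec Py_x Dy_x mulr0 !addr0 /sinner !rmorphD rmorphN !rmorphM /=.
    rewrite sx hex linearZ /= !scalerDr !scalerA divff // !scale1r.
    by rewrite -scalerAr -scalerAl scalerN.
  split=> [/(scalerI hu) -> | /eqP]; first by rewrite subrr.
  by rewrite subr_eq0 => /eqP ->.
have Ey : eta (delta y) = delta (eta y) <->
    (d * sigma x - x * d) + (v^-1 *: eta (Py y) - Px x)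
      + (v^-1 *: (eta l2 * eta (Dy y)) - l1 * Dx x) = 0.
  have eq1 := sub_regroup (eta w * sigma x) (w * sigma x) (x * eta w) (x * w)
    (v^-1 *: eta (Py y)) (Px x) (v^-1 *: (eta l2 * eta (Dy y))) (l1 * Dx x).
  rewrite /d mulrBl mulrBr -eq1.
  have -> : delta (eta y) = v *: (w * sigma x - x * w + Px x + l1 * Dx x).
    by rewrite hey linearZ /= hdec Py_x Dy_x mulr0 !addr0.
  have -> : eta (delta y) = v *: (eta w * sigma x - x * eta w
      + v^-1 *: eta (Py y) + v^-1 *: (eta l2 * eta (Dy y))).
    rewrite hdec Px_y Dx_y mulr0 !addr0 /sinner !rmorphD rmorphN !rmorphM /=.
    rewrite sy hey linearZ /= !scalerDr !scalerA divff // !scale1r.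
    by rewrite -scalerAr -scalerAl scalerN.
  split=> [/(scalerI hv) -> | /eqP]; first by rewrite subrr.
  by rewrite subr_eq0 => /eqP ->.
clearbody d.
case: (eqVneq gamma 1) => [g1 | gn1].
  have gN1 : (gamma == -1) = false by rewrite g1 (negPf one_neqN1).
  have Px0 : forall c, Px c = 0 by move: hPx; rewrite /is_Px gN1.
  have Py0 : forall c, Py c = 0 by move: hPy; rewrite /is_Py gN1.
  have [_ Dxx _] : [/\ sderivation sigma Dx, Dx x = x & Dx y = 0].
    by move: hDx; rewrite /is_Dx g1 eqxx.
  have [_ _ Dyy] : [/\ sderivation sigma Dy, Dy x = 0 & Dy y = y].
    by move: hDy; rewrite /is_Dy g1 eqxx.
  have {}Ex : eta (delta x) = delta (eta x) <->
      d * sigma y - y * d + (eta l1 - l2) * y = 0.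
    rewrite Ex Px0 Py0 rmorph0 scaler0 subr0 addr0 Dxx Dyy hex.
    by rewrite -scalerAr scalerA mulVf // scale1r mulrBl.
  have {}Ey : eta (delta y) = delta (eta y) <->
      d * sigma x - x * d + (eta l2 - l1) * x = 0.
    rewrite Ey Px0 Py0 rmorph0 scaler0 subr0 addr0 Dxx Dyy hey.
    by rewrite -scalerAr scalerA mulVf // scale1r mulrBl.
  have hsx1 : sigma x = x by rewrite hsx g1 scale1r.
  have hsy1 : sigma y = y by rewrite hsy g1 scale1r.
  rewrite /cflip g1 eqxx !scale1r; split.
    move=> /iso[/Ex Ex0 /Ey Ey0].
    have m1 : eta l1 - l2 = 0.
      apply: (commutator_y_separation fx fy fK (D := d)); last by rewrite hsy1 in Ex0.
      exact: (kx2y2B xy fx fy fK).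
    have m2 : eta l2 - l1 = 0.
      apply: (commutator_x_separation fx fy fK (D := d)); last by rewrite hsx1 in Ey0.
      exact: (kx2y2B xy fx fy fK).
    split; last by move=> _; split; apply/esym/eqP; rewrite -subr_eq0 ?m1 ?m2.
      apply/centd; split; apply/eqP; rewrite -subr_eq0.
        by rewrite -Ey0 m2 mul0r addr0.
      by rewrite -Ex0 m1 mul0r addr0.
    by move/eqP; rewrite (negPf one_neqN1).
  case=> /centd[dx dy] _ /(_ (or_introl erefl)) [e1 e2].
  apply/iso; split.
    by apply/Ex; rewrite dy subrr -e2 subrr mul0r addr0.
  by apply/Ey; rewrite dx subrr -e1 subrr mul0r addr0.
case: (eqVneq gamma (-1)) => [gN1 | gnN1]; last first.
  have Px0 : forall c, Px c = 0 by move: hPx; rewrite /is_Px (negPf gnN1).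
  have Py0 : forall c, Py c = 0 by move: hPy; rewrite /is_Py (negPf gnN1).
  have Dx0 : forall c, Dx c = 0.
    by move: hDx; rewrite /is_Dx (negPf gn1) (negPf gnN1).
  have Dy0 : forall c, Dy c = 0.
    by move: hDy; rewrite /is_Dy (negPf gn1) (negPf gnN1).
  rewrite Px0 Py0 Dx0 Dy0 !rmorph0 !mulr0 !scaler0 !subr0 !addr0 in Ex Ey.
  split=> [/iso[/Ex/eqP Ex0 /Ey/eqP Ey0] | [/centd[dx dy] _ _]].
    split.
    - by apply/centd; split; apply/eqP; rewrite -subr_eq0.
    - by move/eqP; rewrite (negPf gnN1).
    - by case=> /eqP; rewrite ?(negPf gn1) ?(negPf gnN1).
  by apply/iso; split; [apply/Ex; rewrite dy subrr | apply/Ey; rewrite dx subrr].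
have [_ Pxx _] : [/\ sderivation sigma Px, Px x = horner_alg y a & Px y = 0].
  by move: hPx; rewrite /is_Px gN1 eqxx.
have [_ _ Pyy] : [/\ sderivation sigma Py, Py x = 0 & Py y = horner_alg x b].
  by move: hPy; rewrite /is_Py gN1 eqxx.
have [_ Dxx _] : [/\ sderivation sigma Dx, Dx x = y * x * x & Dx y = 0].
  by move: hDx; rewrite /is_Dx (negPf gn1) gN1 eqxx.
have [_ _ Dyy] : [/\ sderivation sigma Dy, Dy x = 0 & Dy y = y * x * y].
  by move: hDy; rewrite /is_Dy (negPf gn1) gN1 eqxx.
pose r := v^-1 *: horner_alg (u *: y) b - horner_alg y a.
pose r' := u^-1 *: horner_alg (v *: x) a - horner_alg x b.
(* eta maps yxx to u^2 v xyy = -u^2 v yxy and yxy to u v^2 xyx = -u v^2 yxx,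
   hence the constant -uv after division by u or v. *)
pose c := cflip gamma u v.
have cE : c = - (u * v) by rewrite /c /cflip (negPf gn1).
have {}Ex : eta (delta x) = delta (eta x) <->
    - (d * y) - y * d + r' - (l2 - c *: eta l1) * (y * x * y) = 0.
  rewrite Ex Pxx Pyy Dxx Dyy rmorph_horner_alg hey -/r' hsy gN1 scaleN1r mulrN.
  have -> : u^-1 *: (eta l1 * eta (y * x * x)) = (c *: eta l1) * (y * x * y).
    rewrite !rmorphM /= hex hey -!(scalerAl, scalerAr) !scalerA.
    by rewrite mulrCA mulVf // mulr1 cE xy mulNr mulrN scaleNr scalerN.
  by rewrite mulrBl opprB.
have {}Ey : eta (delta y) = delta (eta y) <->
    - (d * x) - x * d + r - (l1 - c *: eta l2) * (y * x * x) = 0.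
  rewrite Ey Pxx Pyy Dxx Dyy rmorph_horner_alg hex -/r hsx gN1 scaleN1r mulrN.
  have -> : v^-1 *: (eta l2 * eta (y * x * y)) = (c *: eta l2) * (y * x * x).
    rewrite !rmorphM /= hex hey -!(scalerAl, scalerAr) !scalerA.
    by rewrite -mulrA mulKf // cE [v * u]mulrC xy mulNr mulrN scaleNr scalerN.
  by rewrite mulrBl opprB.
have sxN : sigma x = - x by rewrite hsx gN1 scaleN1r.
have syN : sigma y = - y by rewrite hsy gN1 scaleN1r.
split.
  move=> /iso[/Ex Ex0 /Ey Ey0].
  have [r'0 m1] : r' = 0 /\ l2 - c *: eta l1 = 0.
    apply: (anticommutator_y_separation fx fy fK _ _ Ex0).
      exact/(kx2y2B xy fx fy fK)/(kx2y2Z xy fx fy fK).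
    (* b(x) is b(1 *: x), which puts both terms under the same lemma. *)
    move=> j j_gt0; rewrite nfD nfZ nfN -[x in horner_alg x b]scale1r.
    by rewrite coefB coefCM !(nf_horner_x fx) // mulr0 subrr.
  have [r0 m2] : r = 0 /\ l1 - c *: eta l2 = 0.
    apply: (anticommutator_x_separation fx fy fK _ _ Ey0).
      exact/(kx2y2B xy fx fy fK)/(kx2y2Z xy fx fy fK).
    move=> j i i_gt0; rewrite nfD nfZ nfN -[y in horner_alg y a]scale1r.
    by rewrite !coefB !coefCM !(nf_horner_y fy) // mulr0 subrr.
  split.
  - apply/centd; rewrite sxN syN !mulrN; split; apply/eqP; rewrite -subr_eq0.
      by rewrite -Ey0 r0 m2 mul0r subr0 addr0.
    by rewrite -Ex0 r'0 m1 mul0r subr0 addr0.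
  - by move=> _; split; apply/esym/eqP; rewrite -subr_eq0; apply/eqP.
  - by move=> _; split; apply/eqP; rewrite -subr_eq0; apply/eqP.
case=> /centd[]; rewrite sxN syN !mulrN => dx dy /(_ gN1) [ab ba].
move=> /(_ (or_intror gN1)) [e1 e2]; apply/iso; split.
  apply/Ex; rewrite dy subrr /r' -ba subrr add0r.
  by rewrite {1}e2 subrr mul0r subr0.
apply/Ey; rewrite dx subrr /r -ab subrr add0r.
by rewrite {1}e1 subrr mul0r subr0.
Qed.
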